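(* Let $r\ge2$ and $\delta\ge2$ be integers, and let $H$ be an $r$-uniform hypergraph with $\delta^*(H)=\delta$. Then \[\gamma_{r,H}\ge\frac{\delta}{r}-\frac{1}{\binom{r+\delta-1}{r-1}}.\]
   Context: An $r$-uniform hypergraph $H$ has finite vertex set $V(H)$ and edge set $E(H)\subseteq\binom{V(H)}{r}$. For $U\subseteq V(H)$, $L_H(U)=\{e\setminus U: e\in E(H), U\subseteq e\}$, and for non-empty $H$, $\delta^*(H)=\min\{|L_H(U)|: U\in\binom{V(H)}{r-1},\ |L_H(U)|\neq0\}$. For $m\ge1$, the $m$-shadow $\partial_m(G)$ is the set of $m$-element sets contained in some edge of $G$. Define \[\gamma_{r,H}=\min\left\{\frac{|E(H)|-|E(G)|-1}{|\partial_{r-1}(H)|-|\partial_{r-1}(G)|}: G\subseteq H,\ E(G)\neq\emptyset,\ |\partial_{r-1}(G)|<|\partial_{r-1}(H)|\right\},\] where $G\subseteq H$ means $E(G)\subseteq E(H)$. *)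

(* Defs.v *)
From HB Require Import structures.
From mathcomp Require Import all_boot all_order all_algebra.
Set Implicit Arguments.
Unset Strict Implicit.
Unset Printing Implicit Defensive.

Import Order.TTheory GRing.Theory Num.Theory.

(* The vertex set is the whole finite type V; a hypergraph is determined by its
   edges, so "G is a subhypergraph of H" is inclusion of edge sets. *)
Record hypergraph (r : nat) (V : finType) := Hypergraph {
  edges : {set {set V}};
  edges_uniform : [forall e in edges, #|e| == r]
}.

HB.instance Definition _ (r : nat) (V : finType) :=
  [isSub for @edges r V].
HB.instance Definition _ (r : nat) (V : finType) :=
  [Finite of hypergraph r V by <:].

(* Minimum of F over the i satisfying P; x0 is a dummy value, returned only
   when no i satisfies P. *)
Definition min_over (d : Order.disp_t) (R : orderType d) (x0 : R)
    (I : finType) (P : pred I) (F : I -> R) : R :=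
  if [pick i | P i] is Some i0 then F [arg min_(i < i0 | P i) F i]%O else x0.

Lemma min_overP (d : Order.disp_t) (R : orderType d) (x0 : R)
    (I : finType) (P : pred I) (F : I -> R) :
  (exists i, P i) ->
  (exists2 i, P i & min_over x0 P F = F i) /\
  (forall i, P i -> (min_over x0 P F <= F i)%O).
Proof.
case=> j Pj; rewrite /min_over; case: pickP => [i0 Pi0|/(_ j)]; last by rewrite Pj.
by case: arg_minP => // i Pi minF; split=> //; exists i.
Qed.

Section Hypergraph.
Variables (r : nat) (V : finType).
Implicit Types (G H : hypergraph r V) (U : {set V}).

Definition link H U : {set {set V}} :=
  [set e :\: U | e in edges H & U \subset e].

(* delta^*(H); equal to 0 when H has no edges (and r > 0). *)
Definition pos_codegree H : nat :=
  min_over 0%N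
    (fun U => (#|U| == r - 1)%N && (#|link H U| != 0)%N)
    (fun U => #|link H U|).

Definition shadow (m : nat) G : {set {set V}} :=
  [set A : {set V} | (#|A| == m) && [exists e in edges G, A \subset e]].

Local Open Scope ring_scope.

Definition gamma H : rat :=
  min_over 0
    (fun G : hypergraph r V =>
       [&& edges G \subset edges H, edges G != set0
         & (#|shadow (r - 1) G| < #|shadow (r - 1) H|)%N])
    (fun G : hypergraph r V =>
       (#|edges H|%:R - #|edges G|%:R - 1)
         / (#|shadow (r - 1) H|%:R - #|shadow (r - 1) G|%:R)).

End Hypergraph.

(* Main.v *)
Require Import Defs.
From mathcomp Require Import all_boot all_order all_algebra.
From mathcomp Require Import ring lra.

Import Order.TTheory GRing.Theory Num.Theory.
Local Open Scope ring_scope.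

(** Let [F] be the edges of [H] missing from [G] and [B] the (r-1)-sets lost
    from the shadow. An edge of [H] containing a member of [B] is not in [G],
    so every member of [B] lies in at least [delta] edges of [F]. It suffices
    to show [|F| >= 1 + |B| (delta / r - 1 / C(r+delta-1, r-1))] whenever [F]
    is nonempty. If [|B| >= C(r+delta-1, r-1)], this follows by counting
    incidences. Otherwise induct on [r]: apply the bound to the links of [F]
    and [B] at each vertex covered by [F] and sum; there are at least
    [r+delta-1] such vertices as soon as [B] is nonempty. *)

Section Families.
Variable V : finType.
Implicit Types (F B : {set {set V}}) (U e : {set V}) (v : V).

(** The link stays a family over the same vertex type, so the induction on uniformity never changes
    [V]. *)
Definition family_link F v : {set {set V}} := 
  [set e :\ v | e in [set e in F | v \in e]].

Lemma setD1_inj_in v : {in [pred e : {set V} | v \in e] &, injective (fun e => e :\ v)}.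
Proof. by move=> e e' ve ve' eq_ee'; rewrite -(setD1K ve) -(setD1K ve') eq_ee'. Qed.

Lemma card_family_link F v : #|family_link F v| = #|[set e in F | v \in e]|.
Proof.
apply: card_in_imset => e e'; rewrite !inE => /andP[_ ve] /andP[_ ve'].
exact: setD1_inj_in.
Qed.

Lemma sum_card_family_link F k :
  (forall e, e \in F -> #|e| = k) -> (\sum_v #|family_link F v| = #|F| * k)%N.
Proof.
move=> Fk; rewrite -sum_nat_const.
under eq_bigr do rewrite card_family_link -sum1dep_card big_mkcondr /=.
rewrite exchange_big; apply: eq_bigr => e eF.
by rewrite -(Fk e eF) -sum1_card [RHS]big_mkcond.
Qed.

Definition codegree F U : nat := #|[set e in F | U \subset e]|.

(** Deleting [v] is injective on the edges containing [U]. This carries the codegree hypothesis over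
    to links in the induction. *)
Lemma leq_codegree_link F U v :
  v \in U -> (codegree F U <= codegree (family_link F v) (U :\ v))%N.
Proof.
move=> vU; rewrite /codegree.
rewrite -(@card_in_imset _ _ (fun e => e :\ v) (mem [set e in F | U \subset e])); last first.
  move=> e e'; rewrite !inE => /andP[_ /subsetP Ue] /andP[_ /subsetP Ue'].
  by apply: setD1_inj_in; rewrite inE; auto.
apply/subset_leq_card/subsetP => _ /imsetP[e /[!inE] /andP[eF Ue] ->].
rewrite setSD // andbT; apply/imsetP; exists e => //.
by rewrite inE eF (subsetP Ue).
Qed.

(** Some edge contains [U], so its [k] vertices are covered; each edge over [U] adds one further
    vertex, and distinct edges add distinct ones. *)
Lemma card_cover_ge F U k :
  (forall e, e \in F -> #|e| = k.+1) -> #|U| = k -> (0 < codegree F U)%N ->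
  (k + codegree F U <= #|cover F|)%N.
Proof.
move=> Fk Uk /card_gt0P[e0 /[!inE] /andP[e0F Ue0]].
have UF : U \subset cover F by apply: subset_trans Ue0 (bigcup_sup _ e0F).
rewrite -(cardsID U (cover F)) (setIidPr UF) Uk leq_add2l /codegree.
rewrite -(card_imset (cover F :\: U) (@set1_inj V)).
rewrite -(@card_in_imset _ _ (fun e => e :\: U) (mem [set e in F | U \subset e])); last first.
  move=> e e'; rewrite !inE => /andP[_ /setIidPr Ue] /andP[_ /setIidPr Ue'] eqD.
  by rewrite -(setID e U) -(setID e' U) Ue Ue' eqD.
apply/subset_leq_card/subsetP => _ /imsetP[e /[!inE] /andP[eF Ue] ->].
have /cards1P[x ex] : #|e :\: U| == 1%N.
  by rewrite cardsD (setIidPr Ue) Uk (Fk e eF) subSnn.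
rewrite ex; apply: imset_f; rewrite inE.
have : x \in e :\: U by rewrite ex set11.
rewrite inE => /andP[-> xe] /=.
by apply/bigcupP; exists e.
Qed.

(** Count the pairs [U \subset e]: an edge has only [k.+1] subsets of size [k]. *)
Lemma codegree_double_count F B k d :
  (forall e, e \in F -> #|e| = k.+1) -> (forall U, U \in B -> #|U| = k) ->
  (forall U, U \in B -> (d <= codegree F U)%N) ->
  (#|B| * d <= k.+1 * #|F|)%N.
Proof.
move=> Fk Bk Bd; rewrite -sum_nat_const.
apply: (@leq_trans (\sum_(U in B) codegree F U)); first exact: leq_sum.
rewrite /codegree; under eq_bigr do rewrite -sum1dep_card big_mkcondr /=.
rewrite exchange_big mulnC -sum_nat_const; apply: leq_sum => e eF /=.
rewrite -big_mkcondr /= sum1dep_card.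
have <- : #|[set A : {set V} | A \subset e & #|A| == k]| = k.+1.
  by rewrite cards_draws Fk // binSn.
apply/subset_leq_card/subsetP => U; rewrite !inE => /andP[UB ->].
by rewrite Bk ?eqxx.
Qed.

(** Here [k] is the uniformity less one. The summand [1] drives the induction: summed over links, it
    contributes the number of covered vertices. *)
Lemma family_card_ge (R : realFieldType) d : (0 < d)%N -> forall k F B,
  (forall e, e \in F -> #|e| = k.+1) -> (forall U, U \in B -> #|U| = k) ->
  (forall U, U \in B -> (d <= codegree F U)%N) -> F != set0 ->
  1 + #|B|%:R * (d%:R / k.+1%:R - 1 / 'C(k + d, k)%:R) <= #|F|%:R :> R.
Proof.
move=> d_gt0; elim=> [|k IHk] F B Fk Bk Bd F0.
  (* For [k = 0], [B] contains at most the empty set; if it does, the bound reads [d <= #|F|]. *)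
  rewrite bin0 !divr1.
  have F1 : (1 <= #|F|)%N by rewrite card_gt0.
  have [->|[U UB]] := set_0Vmem B; first by rewrite cards0 mul0r addr0 ler1n.
  have B1 : (#|B| <= 1)%N.
    apply/card_le1P => U1 U1B U2; rewrite inE.
    apply/idP/eqP => [U2B|->//].
    by rewrite (cards0_eq (Bk _ U1B)) (cards0_eq (Bk _ U2B)).
  have B1' : #|B| = 1%N.
    by apply/eqP; rewrite eqn_leq B1 card_gt0; apply/set0Pn; exists U.
  have dF : (d <= #|F|)%N.
    apply: leq_trans (Bd U UB) _; apply/subset_leq_card/subsetP => e.
    by rewrite inE => /andP[].
  by rewrite B1' mul1r addrC subrK ler_nat.
set C := 'C(_, _).
have C_gt0 : 0 < C%:R :> R by rewrite ltr0n bin_gt0 leq_addr.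
(* For large [B], [1 - #|B| / C <= 0], so the double count alone suffices. *)
have [leCB|ltBC] := leqP C #|B|.
  have := @codegree_double_count F B _ _ Fk Bk Bd.
  rewrite -(ler_nat R) !natrM => dc.
  have CB : 1 <= #|B|%:R / C%:R :> R by rewrite ler_pdivlMr // mul1r ler_nat.
  have : #|B|%:R * d%:R / k.+2%:R <= #|F|%:R :> R.
    by rewrite ler_pdivrMr ?ltr0Sn // [X in _ <= X]mulrC.
  by move=> dF; rewrite mulrBr !mulrA mulr1 addrCA -[#|F|%:R]addr0 lerD // subr_le0.
have [B0|[U0 U0B]] := set_0Vmem B.
  by rewrite B0 cards0 mul0r addr0 ler1n card_gt0.
set C' := 'C(k + d, k) in IHk.
have C'_gt0 : 0 < C'%:R :> R by rewrite ltr0n bin_gt0 leq_addr.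
have CC' : (k + d).+1%:R * C'%:R = k.+1%:R * C%:R :> R.
  by rewrite -!natrM /C addSn mul_bin_diag.
have coverB v : v \notin cover F -> family_link B v = set0.
  move=> vF; apply/eqP; rewrite -cards_eq0 card_family_link cards_eq0.
  apply/eqP/setP => U; rewrite !inE; apply/negP => /andP[UB vU].
  have /card_gt0P[e /[!inE] /andP[eF Ue]] := leq_trans d_gt0 (Bd U UB).
  by case/negP: vF; apply/bigcupP; exists e => //; apply: (subsetP Ue).
(* The indicator covers both cases: the induction hypothesis at covered vertices, empty links
   elsewhere. *)
have link_ge v :
    (v \in cover F)%:R + #|family_link B v|%:R * (d%:R / k.+1%:R - 1 / C'%:R)
      <= #|family_link F v|%:R :> R.
  have [vF|/coverB->] := boolP (v \in cover F); last first.
    by rewrite cards0 mul0r addr0 ler0n.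
  apply: IHk => [_ /imsetP[e /[!inE] /andP[eF ve] ->]|_ /imsetP[U /[!inE] /andP[UB vU] ->]|_ /imsetP[U /[!inE] /andP[UB vU] ->]|].
  - by have := Fk e eF; rewrite (cardsD1 v) ve => -[].
  - by have := Bk U UB; rewrite (cardsD1 v) vU => -[].
  - exact: leq_trans (Bd U UB) (leq_codegree_link _ _ _ vU).
  - case/bigcupP: vF => e eF ve; apply/set0Pn; exists (e :\ v).
    by apply: imset_f; rewrite inE eF.
have := ler_sum (index_enum V) (fun v (_ : true) => link_ge v).
rewrite big_split -mulr_suml -!natr_sum /=.
rewrite (sum_card_family_link _ _ Fk) (sum_card_family_link _ _ Bk).
rewrite -big_mkcond sum1_card.
(* The sum now has [#|cover F|] as its constant term; a single member [U0] of [B] forces this to be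
   at least [k.+1 + d]. *)
have := @card_cover_ge F U0 _ Fk (Bk _ U0B) (leq_trans d_gt0 (Bd _ U0B)).
have := Bd _ U0B; move: (codegree F U0) => c dc coverc.
have : (k.+1 + d <= #|cover F|)%N by apply: leq_trans coverc; rewrite leq_add2l.
rewrite -(ler_nat R) !natrM.
have ltbC : #|B|%:R < C%:R :> R by rewrite ltr_nat.
move: (#|cover F|%:R : R) (#|F|%:R : R) (#|B|%:R : R) ltbC => N f b ltbC leN.
have d1 : 1 <= d%:R :> R by rewrite ler1n.
have k0 : 0 <= k%:R :> R by rewrite ler0n.
clearbody C C'; move: CC' leN; rewrite -!natr1 !natrD -?natr1.
move: (k%:R : R) (d%:R : R) (C%:R : R) (C'%:R : R) d1 k0 C_gt0 C'_gt0 ltbC.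
move=> K D c1 c2 D1 K0 c1_gt0 c2_gt0 ltbC CC' leN sum_ge.
have c2E : (K + 1) / c2 = (K + D + 1) / c1.
  by apply/eqP; rewrite eqr_div ?lt0r_neq0 // CC'.
have E : b * (K + 1) * (D / (K + 1) - 1 / c2) = b * D - b * ((K + D + 1) / c1).
  rewrite -c2E; field; lra.
rewrite E in sum_ge.
have x1 : b / c1 <= 1 by rewrite ler_pdivrMr // mul1r ltW.
have x1K : b * ((K + D + 1) / c1) = (K + D + 1) * (b / c1) by ring.
rewrite x1K in sum_ge.
have -> : 1 + b * (D / (K + 1 + 1) - 1 / c1) = 1 - b / c1 + (b * D) / (K + 1 + 1).
  by ring.
have K2 : 0 < K + 1 + 1 by lra.
rewrite -(ler_pM2r K2) mulrDl divfK ?gt_eqF //.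
move: (b / c1) x1 sum_ge => x x1 sum_ge.
(* With [x = b / c1], the summed bound has [(K + D + 1) * (1 - x)] where the goal has
   [(K + 2) * (1 - x)]; this product is the surplus. *)
have : 0 <= (1 - x) * (D - 1) by rewrite mulr_ge0 ?subr_ge0.
lra.
Qed.

End Families.

Section Shadows.
Variables (r : nat) (V : finType).
Implicit Types (G H : hypergraph r V) (U e : {set V}).

Lemma edge_card H e : e \in edges H -> #|e| = r.
Proof. by move: (edges_uniform H) => /forall_inP/(_ e)/[apply]/eqP. Qed.

Lemma subset_shadow m G H :
  edges G \subset edges H -> shadow m G \subset shadow m H.
Proof.
move=> /subsetP GH; apply/subsetP => U; rewrite !inE => /andP[->] /=.
by case/exists_inP => e /GH eH Ue; apply/exists_inP; exists e.
Qed.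

Lemma link_card_le H U : (#|link H U| <= codegree V (edges H) U)%N.
Proof.
apply: leq_trans (leq_imset_card _ _) _.
by apply/subset_leq_card/subsetP => e; rewrite !inE.
Qed.

(** An edge over [U] makes its link nonempty, so [U] competes in the minimum. *)
Lemma pos_codegree_le H U :
  U \in shadow (r - 1) H -> (pos_codegree H <= codegree V (edges H) U)%N.
Proof.
rewrite inE => /andP[Ur /exists_inP[e eH Ue]].
have PU : (#|U| == r - 1)%N && (#|link H U| != 0)%N.
  rewrite Ur -lt0n; apply/card_gt0P; exists (e :\: U).
  by apply: imset_f; rewrite inE eH.
apply: leq_trans (link_card_le H U).
rewrite /pos_codegree.
set P := (fun U => _ && _); set f := (fun U => #|_|).
by have [_ /(_ U PU)] := @min_overP _ _ 0%N _ P f (ex_intro _ U PU).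
Qed.

(** Without edges all links are empty and the minimum takes its dummy value 0. *)
Lemma pos_codegree_edge H : (0 < pos_codegree H)%N -> exists e, e \in edges H.
Proof.
move=> H0; apply/set0Pn; apply: contraL H0 => /eqP H0.
rewrite -eqn0Ngt /pos_codegree /min_over; case: pickP => // U /andP[_].
case/negP; rewrite cards_eq0; apply/eqP/setP => e; rewrite [RHS]inE.
by apply/imsetP => -[e']; rewrite inE H0 inE.
Qed.

End Shadows.

(** Codegree at least 2 yields a second edge [e'] with a vertex [y] outside [e]; deleting another
    vertex [z] of [e'] leaves a shadow set containing [y], hence new. *)
Lemma card_shadow_edge_lt r (V : finType) (G H : hypergraph r.+2 V) e :
  edges G = [set e] -> e \in edges H -> (1 < pos_codegree H)%N ->
  (#|shadow r.+1 G| < #|shadow r.+1 H|)%N.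
Proof.
move=> GE eH H1; have cardE := @edge_card _ _ H.
have [x xe] : exists x, x \in e by apply/card_gt0P; rewrite cardE.
have exH : e :\ x \in shadow (r.+2 - 1) H.
  rewrite inE; apply/andP; split; last by apply/exists_inP; exists e; rewrite ?subsetDl.
  by have := cardE _ eH; rewrite (cardsD1 x) xe add1n subSS subn0 => -[->].
have [e' e'H e'e] : exists2 e', e' \in edges H & e' != e.
  have := leq_trans H1 (pos_codegree_le _ _ _ _ exH).
  rewrite /codegree (cardsD1 e) inE eH subsetDl add1n ltnS.
  case/card_gt0P => e'.
  by rewrite !inE => /andP[e'e /andP[e'H _]]; exists e'.
have /subsetPn[y ye' yNe] : ~~ (e' \subset e).
  by apply: contra e'e => sub; rewrite eqEcard sub (cardE _ eH) (cardE _ e'H) leqnn.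
have [z ze'] : exists z, z \in e' :\ y.
  by apply/card_gt0P; have := cardE _ e'H; rewrite (cardsD1 y) ye' add1n => -[->].
move: ze'; rewrite !inE => /andP[zy ze'].
apply/proper_card/properP; split; first by apply: subset_shadow; rewrite GE sub1set.
exists (e' :\ z).
  rewrite inE; apply/andP; split; last by apply/exists_inP; exists e'; rewrite ?subsetDl.
  by have := cardE _ e'H; rewrite (cardsD1 z) ze' add1n => -[->].
rewrite inE negb_and; apply/orP; right; apply/exists_inP => -[e0].
rewrite GE inE => /eqP-> /subsetP/(_ y); rewrite !inE ye' eq_sym zy => /(_ isT).
exact/negP.
Qed.

Theorem theorem6p7 (r delta : nat) (V : finType) (H : hypergraph r V)
  (hr : (2 <= r)%N) (hdelta : (2 <= delta)%N)
  (hH : pos_codegree H = delta) :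
  delta%:R / r%:R - 1 / 'C(r + delta - 1, r - 1)%:R <= gamma H.
Proof.
have delta_gt0 : (0 < delta)%N by apply: leq_trans hdelta.
(* The binomial becomes ['C(r.+1 + delta, r.+1)], matching [family_card_ge] at [k = r.+1]. *)
case: r hr H hH => [|[|r]] // hr H hH; rewrite /gamma addSn !subSS !subn0.
set P := (fun G => _); set f := (fun G => _).
have [e eH] : exists e, e \in edges H by apply: pos_codegree_edge; rewrite hH.
(* A one-edge subhypergraph is admissible, so [gamma H] is a true minimum and not the dummy 0. *)
have exP : exists G, P G.
  have uni_e : [forall e' in [set e], #|e'| == r.+2].
    by apply/forall_inP => e' /set1P->; rewrite (edge_card _ _ H).
  exists (Hypergraph uni_e); rewrite /P /= sub1set eH /=.
  apply/andP; split; first by apply/set0Pn; exists e; rewrite set11.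
  by apply: card_shadow_edge_lt eH _; rewrite ?hH.
have [[G PG ->] _] := @min_overP _ _ (0 : rat) _ P f exP.
case/and3P: PG => GH _ ltGH; rewrite /f.
have sGH := @subset_shadow _ _ r.+1 _ _ GH.
set F := edges H :\: edges G; set B := shadow r.+1 H :\: shadow r.+1 G.
have cF : #|F|%:R = #|edges H|%:R - #|edges G|%:R :> rat.
  by rewrite cardsD (setIidPr GH) natrB ?subset_leq_card.
have cB : #|B|%:R = #|shadow r.+1 H|%:R - #|shadow r.+1 G|%:R :> rat.
  by rewrite cardsD (setIidPr sGH) natrB ?subset_leq_card.
have B_gt0 : 0 < #|B|%:R :> rat by rewrite cB subr_gt0 ltr_nat.
rewrite -cF -cB ler_pdivlMr // lerBrDl mulrC.
(* No edge over a lost set lies in [G], so all its edges in [H] remain in [F]. *)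
have Bd U : U \in B -> (delta <= codegree V F U)%N.
  rewrite inE => /andP[UG UH]; rewrite -hH.
  apply: leq_trans (@pos_codegree_le _ _ H U _) _; first by rewrite subSS subn0.
  apply/subset_leq_card/subsetP => e'; rewrite !inE => /andP[e'H Ue'].
  rewrite e'H Ue' !andbT; apply: contra UG => e'G; move: UH; rewrite !inE => /andP[-> _].
  by apply/exists_inP; exists e'.
have [U UB] : exists U, U \in B by apply/card_gt0P; rewrite -(ltr0n rat).
apply: family_card_ge => //.
- by move=> e'; rewrite inE => /andP[_]; apply: edge_card.
- by move=> U'; rewrite !inE => /andP[_ /andP[/eqP]].
- have /card_gt0P[e' /[!inE] /andP[e'F _]] := leq_trans delta_gt0 (Bd U UB).
  by apply/set0Pn; exists e'; rewrite inE.
Qed.
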